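(* Let $K$ be a number field, $c\in K$, $c\neq 0$, and $\mathcal{E}_2: y^2=x^3+c$, with $K_7=K(\mathcal{E}_2[7])$. Consider the conditions: A: $\zeta_3\notin K$; B1: $\zeta_7+\zeta_7^{-1}\notin K(\zeta_3)$; B2: $\zeta_7\notin K(\zeta_3,\zeta_7+\zeta_7^{-1})$; C: $\sqrt[3]{\delta_1c}\notin K(\zeta_3,\zeta_7)$; D: $\sqrt{(\delta_1+1)c}\notin K(\zeta_3,\zeta_7)$. Then the possible degrees $d=[K_7:K]$, with the conditions that hold (the remaining ones failing), are: $d=72$: A, B1, B2, C, D; $d=36$: B1, C and two among A, B2, D; $d=24$: one between B1, C, and A, B2, D; $d=18$: B1, C and one among A, B2, D; $d=12$: one between B1, C and two among A, B2, D; $d=9$: B1, C; $d=8$: A, B2, D; $d=6$: one between B1, C and one among A, B2, D; $d=4$: two among A, B2, D; $d=3$: one between B1, C; $d=2$: one among A, B2, D; $d=1$: no condition holds.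
   Context: $K(\mathcal{E}[m])$ is the field generated over $K$ by the coordinates of the $m$-torsion points. Fix a primitive cube root of unity $\zeta_3$ and a primitive $7$th root of unity $\zeta=\zeta_7$ in $\overline K$, and let $\delta_1=-\big((-132\zeta_3-120)\zeta^5+(-168\zeta_3-12)\zeta^4+(-24\zeta_3+60)\zeta^3+(-60\zeta_3-84)\zeta^2+(-192\zeta_3-96)\zeta-96\zeta_3+52\big)$. Cube and square roots denote fixed choices in $\overline K$. *)

(* Defs.v *)
From HB Require Import structures.
From mathcomp Require Import all_boot all_order all_algebra all_field.

Set Implicit Arguments.
Unset Strict Implicit.
Unset Printing Implicit Defensive.

Import GRing.Theory.
Local Open Scope ring_scope.

(* Subfields of a field L are Prop-valued predicates on L: membership in a
   generated subfield need not be decidable a priori. *)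
Definition is_subfield (L : fieldType) (F : L -> Prop) : Prop :=
  [/\ F 1,
      forall x y, F x -> F y -> F (x - y),
      forall x y, F x -> F y -> F (x * y)
    & forall x, F x -> F x^-1].

Definition field_image (K L : fieldType) (iota : K -> L) : L -> Prop :=
  fun z => exists a : K, z = iota a.

Definition adjoin (L : fieldType) (E S : L -> Prop) : L -> Prop :=
  fun z => forall F : L -> Prop,
    is_subfield F -> (forall x, E x -> F x) -> (forall x, S x -> F x) -> F z.

Definition adjoin_seq (L : fieldType) (E : L -> Prop) (s : seq L) : L -> Prop :=
  adjoin E (fun z => z \in s).

(* [F : E] = d, i.e. F has an E-basis with d elements. *)
Definition has_degree (L : fieldType) (E F : L -> Prop) (d : nat) : Prop :=
  exists e : 'I_d -> L,
    (forall i, F (e i)) /\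
    (forall z, F z ->
       exists! a : {ffun 'I_d -> L},
         (forall i, E (a i)) /\ z = \sum_(i < d) a i * e i).

(* Points of y^2 = x^3 + a x + b; None is the point at infinity. *)
Definition ec_on_curve (L : fieldType) (a b : L) (P : option (L * L)) : Prop :=
  if P is Some (x, y) then y ^+ 2 = x ^+ 3 + a * x + b else True.

(* Chord-and-tangent addition, meaningful on points of the curve: there,
   x1 = x2 and y1 <> - y2 force y1 = y2 <> 0. *)
Definition ec_add (L : fieldType) (a : L) (P Q : option (L * L)) :
    option (L * L) :=
  match P, Q with
  | None, _ => Q
  | _, None => P
  | Some (x1, y1), Some (x2, y2) =>
      if (x1 == x2) && (y1 == - y2) then None
      else
        let l := if x1 == x2 then (3%:R * x1 ^+ 2 + a) / (2%:R * y1)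
                 else (y2 - y1) / (x2 - x1) in
        let x3 := l ^+ 2 - x1 - x2 in
        Some (x3, l * (x1 - x3) - y1)
  end.

Definition ec_mul (L : fieldType) (a : L) (m : nat) (P : option (L * L)) :
    option (L * L) := iter m (ec_add a P) None.

Definition ec_torsion (L : fieldType) (a b : L) (m : nat)
    (P : option (L * L)) : Prop :=
  ec_on_curve a b P /\ ec_mul a m P = None.

Definition torsion_coord (L : fieldType) (a b : L) (m : nat) : L -> Prop :=
  fun z => exists x y : L,
    ec_torsion a b m (Some (x, y)) /\ (z = x \/ z = y).

(* E is the base field, viewed inside an algebraic closure L of it. *)
Definition torsion_field (L : fieldType) (E : L -> Prop) (a b : L) (m : nat) :
    L -> Prop := adjoin E (torsion_coord a b m).

Definition delta1 (L : fieldType) (z3 z : L) : L :=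
  - ((- 132%:R * z3 - 120%:R) * z ^+ 5
     + (- 168%:R * z3 - 12%:R) * z ^+ 4
     + (- 24%:R * z3 + 60%:R) * z ^+ 3
     + (- 60%:R * z3 - 84%:R) * z ^+ 2
     + (- 192%:R * z3 - 96%:R) * z
     - 96%:R * z3 + 52%:R).

Definition one_of2 (P Q : Prop) : Prop := (P /\ ~ Q) \/ (~ P /\ Q).

Definition none_of2 (P Q : Prop) : Prop := ~ P /\ ~ Q.

Definition two_of3 (P Q R : Prop) : Prop :=
  [\/ [/\ P, Q & ~ R], [/\ P, ~ Q & R] | [/\ ~ P, Q & R]].

Definition one_of3 (P Q R : Prop) : Prop :=
  [\/ [/\ P, ~ Q & ~ R], [/\ ~ P, Q & ~ R] | [/\ ~ P, ~ Q & R]].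

Definition none_of3 (P Q R : Prop) : Prop := [/\ ~ P, ~ Q & ~ R].

(* Main.v *)
Require Import Defs.
From HB Require Import structures.
From mathcomp Require Import all_boot all_order all_algebra all_field.
From mathcomp Require Import ring.
From Stdlib Require Import Classical.

Set Implicit Arguments.
Unset Strict Implicit.
Unset Printing Implicit Defensive.

Import GRing.Theory.
Local Open Scope ring_scope.

(* Write w, z for the roots of unity of order 3 and 7 and u = x^3 / (4 c).  The
   multiples of a point P = (x, y) of y^2 = x^3 + c are (x f, y g) with f and g
   rational functions of u alone, so 7 P = 0 amounts to a polynomial equation in
   u of degree 8.  It splits over Q(w, z): two roots lie in Q(w), and the other
   six are the conjugates under z -> z^j of delta_1 / 4; they recover z.  The
   endomorphisms sqrt(-3), 2 - w and 2 - w^2 of the curve carry a point above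
   delta_1 / 4 to points above the other seven roots, with coordinates
   multiplied by elements of Q(w, z).  Hence (r, s) is a point of order 7 and
   K(E[7]) = K(w, z, r, s).
   The degree is then read off the tower K, K(w), K(w, z + 1/z), K(w, z),
   K(w, z, r), K(w, z, r, s).  Each step is generated
     by a root of a quadratic, or
   of a cubic all of whose roots are rational over the field of any one of them,
   so it has degree 1 or the full degree; s is tested over K(w, z) already
   because adjoining r is a step of odd degree. *)

(** * Multiplication by 7 on y^2 = x^3 + c *)

(* Up to constants and monomials in x, y and c, these are the division
   polynomials psi_3, ..., psi_6 of y^2 = x^3 + c in the variable
   u = x^3 / (4 c), and psi_7 is the product of [psi7_ker] and [psi7_gen].
   Since 7 = p p' in the endomorphism ring Z[zeta_3], the roots of [psi7_ker]
   come from the points killed by p or p'; the other points of order 7, given by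
   [psi7_gen], each generate E[7] as a Z[zeta_3]-module. *)
Definition psi3 (R : pzRingType) (u : R) : R := u + 1.
Definition psi4 (R : pzRingType) (u : R) : R := 2 * u ^+ 2 + 10 * u - 1.
Definition psi5 (R : pzRingType) (u : R) : R :=
  5 * u ^+ 4 + 95 * u ^+ 3 - 15 * u ^+ 2 - 25 * u - 1.
Definition psi6 (R : pzRingType) (u : R) : R :=
  u ^+ 4 + 55 * u ^+ 3 - 111 * u ^+ 2 - 5 * u - 2.
Definition psi7_ker (R : pzRingType) (u : R) : R := 7 * u ^+ 2 - u + 1.
Definition psi7_gen (R : pzRingType) (u : R) : R :=
  u ^+ 6 + 141 * u ^+ 5 - 363 * u ^+ 4 - 1924 * u ^+ 3 - 741 * u ^+ 2
  - 48 * u + 1.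

Lemma natSr_neq0 (L : fieldType) n : [pchar L] =i pred0 -> n.+1%:R != 0 :> L.
Proof. by move/pcharf0P->. Qed.

Section Multiples.

Variables (L : fieldType) (x y c u : L).
Hypothesis L0 : [pchar L] =i pred0.
Hypotheses (c_neq0 : c != 0) (x3 : x ^+ 3 = 4 * u * c).
Hypothesis y2 : y ^+ 2 = (4 * u + 1) * c.

Let nz2 : 2 != 0 :> L. Proof. exact: natSr_neq0. Qed.
Let nz3 : 3 != 0 :> L. Proof. exact: natSr_neq0. Qed.
Let nz4 : 4 != 0 :> L. Proof. exact: natSr_neq0. Qed.

(** The cofactors are integral Bezout coefficients: [psi7_gen] and each of these polynomials
    generate over Z an ideal containing a power of 3, nonzero in characteristic 0. Hence no
    denominator in the formulas for 2 P, ..., 6 P vanishes. *)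
Lemma coprime_psi7_gen : psi7_gen u = 0 ->
  [/\ u != 0, 4 * u + 1 != 0 & [/\ psi3 u != 0, psi4 u != 0, psi5 u != 0
    & psi6 u != 0]].
Proof.
move=> u7; have bezout (a b v w : L) n : a = 0 ->
    v * a + w * b = 3 ^+ n -> b != 0.
  move=> -> e; apply/eqP => b0; have/eqP[] := expf_neq0 n nz3.
  by rewrite -e b0 !mulr0 addr0.
split; last split.
- apply: (bezout _ _ 1 (- u ^+ 5 - 141 * u ^+ 4 + 363 * u ^+ 3
    + 1924 * u ^+ 2 + 741 * u + 48) 0 u7).
  by rewrite /psi7_gen; ring.
- apply: (bezout _ _ (- 4096%:R) (1024 * u ^+ 5 + 144128%:R * u ^+ 4
    - 407744%:R * u ^+ 3 - 1868240%:R * u ^+ 2 - 291724%:R * u + 23779%:R)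
    9 u7).
  by rewrite /psi7_gen; ring.
- apply: (bezout _ _ 1 (- u ^+ 5 - 140 * u ^+ 4 + 503 * u ^+ 3
    + 1421 * u ^+ 2 - 680 * u + 728) 6 u7).
  by rewrite /psi7_gen /psi3; ring.
- apply: (bezout _ _ (- 896 * u - 4568) (448 * u ^+ 5 + 63212%:R * u ^+ 4
    - 156416%:R * u ^+ 3 - 877358%:R * u ^+ 2 - 417802%:R * u - 63617%:R)
    10 u7).
  by rewrite /psi7_gen /psi4; ring.
- apply: (bezout _ _ (- 173750%:R * u ^+ 3 - 3298425%:R * u ^+ 2
    + 576525%:R * u + 889825%:R)
    (34750%:R * u ^+ 5 + 4899185%:R * u ^+ 4 - 12694235%:R * u ^+ 3
     - 66698855%:R * u ^+ 2 - 24522625%:R * u - 704498%:R) 13 u7).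
  by rewrite /psi7_gen /psi5; ring.
- apply: (bezout _ _ (1280 * u ^+ 3 + 69219%:R * u ^+ 2 - 206997%:R * u
    + 126797%:R)
    (- 1280 * u ^+ 5 - 179299%:R * u ^+ 4 + 631123%:R * u ^+ 3
     + 2028643%:R * u ^+ 2 - 1312219%:R * u - 733763%:R) 13 u7).
  by rewrite /psi7_gen /psi6; ring.
Qed.

Let P := Some (x, y).

(* Every multiple n P is (x f, y g) with f, g in Q(u); it is described by
   e = 1 - f and h = 1 - g, and e = 0 exactly when (n + 1) P = 0. *)
Let pt (e h : L) := Some (x * (1 - e), y * (1 - h)).

(** Here [pt 0 2] is (x, - y), the opposite of P. *)
Let add_pt0 : ec_add 0 P (pt 0 2) = None.
Proof.
rewrite /= subr0 mulr1 eqxx /=; suff -> : y == - (y * (1 - 2)) by [].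
by apply/eqP; ring.
Qed.

Hypotheses (u_neq0 : u != 0) (u1_neq0 : 4 * u + 1 != 0).

Let x_neq0 : x != 0.
Proof.
apply: contraTneq (mulf_neq0 (mulf_neq0 nz4 u_neq0) c_neq0) => x0.
by rewrite -x3 x0 expr0n eqxx.
Qed.

Let y_neq0 : y != 0.
Proof.
apply: contraTneq (mulf_neq0 u1_neq0 c_neq0) => y0.
by rewrite -y2 y0 expr0n eqxx.
Qed.

(** The chord has slope m y / x, and [(4 * u + 1) / (4 * u)] is y^2 / x^3; [e != 0] keeps the two
    abscissas distinct. *)
Let add_pt m e h e' h' : e != 0 -> h = m * e ->
  e' = 3 - e - (4 * u + 1) / (4 * u) * m ^+ 2 -> h' = 2 - m * e' ->
  ec_add 0 P (pt e h) = pt e' h'.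
Proof.
move=> ne Dm De' ->; rewrite /pt /=.
have -> : (x == x * (1 - e)) = false.
  apply/negbTE; rewrite -subr_eq0; have -> : x - x * (1 - e) = x * e by ring.
  exact: mulf_neq0.
have -> : (y * (1 - h) - y) / (x * (1 - e) - x) = y / x * m.
  have -> : x * (1 - e) - x = - (x * e) by ring.
  by rewrite Dm; field; rewrite x_neq0 oppr_eq0 mulf_neq0.
have Ee : (y / x * m) ^+ 2 - x - x * (1 - e) = x * (1 - e').
  suff -> : (y / x * m) ^+ 2 = x * (3 - e - e') by ring.
  rewrite De' !exprMn y2 exprVn.
  have -> : c = x ^+ 3 / (4 * u) by rewrite x3 mulrAC mulfV ?mul1r ?mulf_neq0.
  by field; rewrite x_neq0 u_neq0 nz4.
by rewrite Ee; congr (Some (_, _)); field; rewrite x_neq0.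
Qed.

(** In terms of division polynomials, e_n = 1 - x(n P) / x(P) is psi_{n-1} psi_{n+1} / (x
    psi_n^2). *)
Let e2 := 3 * psi3 u / (4 * u + 1).
Let e3 := (4 * u + 1) * psi4 u / (9 * u * psi3 u ^+ 2).
Let e4 := 3 * psi3 u * psi5 u / ((4 * u + 1) * psi4 u ^+ 2).
Let e5 := 3 * (4 * u + 1) * psi3 u * psi4 u * psi6 u / psi5 u ^+ 2.
Let e6 := psi5 u * psi7_ker u * psi7_gen u
  / (9 * u * (4 * u + 1) * psi3 u ^+ 2 * psi6 u ^+ 2).

(* m_n is the slope of the chord through P and n P, divided by y / x. *)
Let m1 := 6 * u / (4 * u + 1).
Let m2 := 2 * psi7_ker u / (3 * (4 * u + 1) * psi3 u).
Let m3 := 2 * (13 * u ^+ 4 + 13 * u ^+ 3 + 96 * u ^+ 2 + 16 * u + 1)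
  / (3 * (4 * u + 1) * psi3 u * psi4 u).
Let m4 := 6 * u * psi7_ker u * (u ^+ 4 + 10 * u ^+ 3 + 132 * u ^+ 2 + 49 * u +
  7)
  / ((4 * u + 1) * psi4 u * psi5 u).
Let m5 := 2 * (31 * u ^+ 10 + 1333 * u ^+ 9 + 40734%:R * u ^+ 8
  - 7161%:R * u ^+ 7 + 29667%:R * u ^+ 6 + 48015%:R * u ^+ 5
  + 38775%:R * u ^+ 4 + 8328%:R * u ^+ 3 + 315 * u ^+ 2 - 41 * u + 1)
  / (3 * (4 * u + 1) * psi3 u * psi5 u * psi6 u).

Let mul2 : ec_add 0 P P = pt e2 (2 - m1 * e2).
Proof.
rewrite /= eqxx /=.
have -> : (y == - y) = false.
  by rewrite -addr_eq0 -mulr2n -mulr_natl mulf_eq0 (negPf nz2) (negPf y_neq0).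
have hx : x ^+ 3 = 4 * u * y ^+ 2 / (4 * u + 1) by rewrite x3 y2; field.
have El : ((3 * x ^+ 2 + 0) / (2 * y)) ^+ 2 - x - x = x * (1 - e2).
  transitivity (9 * x * x ^+ 3 / (4 * y ^+ 2) - 2 * x).
    by field; rewrite ?y_neq0 ?nz2 ?nz4.
  by rewrite hx /e2 /psi3; field; rewrite ?y_neq0 ?nz2 ?nz4 ?u1_neq0.
rewrite El; congr (Some (_, _)).
transitivity (3 * x ^+ 3 / (2 * y) * e2 - y).
  by field; rewrite ?y_neq0 ?nz2.
by rewrite hx /m1 /e2 /psi7_ker /psi3; field; rewrite ?y_neq0 ?nz2 ?u1_neq0.
Qed.

Let mul3 : psi3 u != 0 -> ec_add 0 P (pt e2 (2 - m1 * e2)) = pt e3 (2 - m2 *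
  e3).
Proof.
move=> n3; apply: (add_pt (m := m2)) => //.
- by rewrite !mulf_neq0 ?invr_eq0.
- rewrite /m1 /m2 /e2 /psi7_ker; rewrite /psi3 in n3 *.
  by field; rewrite n3 nz3 u1_neq0.
rewrite /e3 /e2 /m2 /psi4 /psi7_ker; rewrite /psi3 in n3 *.
by field; rewrite ?n3 ?nz3 ?nz4 ?u1_neq0 ?u_neq0 ?natSr_neq0.
Qed.

Let mul4 : psi3 u != 0 -> psi4 u != 0 ->
  ec_add 0 P (pt e3 (2 - m2 * e3)) = pt e4 (2 - m3 * e4).
Proof.
move=> n3 n4; apply: (add_pt (m := m3)) => //.
- by rewrite !(mulf_neq0, invr_neq0) ?natSr_neq0.
- rewrite /m2 /m3 /e3 /psi7_ker; rewrite /psi3 /psi4 in n3 n4 *.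
  by field; rewrite ?n4 ?n3 ?nz3 ?nz4 ?u1_neq0 ?u_neq0 ?natSr_neq0.
rewrite /e4 /e3 /m3 /psi5; rewrite /psi3 /psi4 in n3 n4 *.
by field; rewrite ?n4 ?n3 ?nz3 ?nz4 ?u1_neq0 ?u_neq0 ?natSr_neq0.
Qed.

Let mul5 : psi3 u != 0 -> psi4 u != 0 -> psi5 u != 0 ->
  ec_add 0 P (pt e4 (2 - m3 * e4)) = pt e5 (2 - m4 * e5).
Proof.
move=> n3 n4 n5; apply: (add_pt (m := m4)) => //.
- by rewrite !(mulf_neq0, invr_neq0) ?natSr_neq0.
- rewrite /m3 /m4 /e4 /psi7_ker; rewrite /psi3 /psi4 /psi5 in n3 n4 n5 *.
  by field; rewrite ?n5 ?n4 ?n3 ?nz3 ?nz4 ?u1_neq0 ?u_neq0 ?natSr_neq0.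
rewrite /e5 /e4 /m4 /psi6 /psi7_ker; rewrite /psi3 /psi4 /psi5 in n3 n4 n5 *.
by field; rewrite ?n5 ?n4 ?n3 ?nz3 ?nz4 ?u1_neq0 ?u_neq0 ?natSr_neq0.
Qed.

Let mul6 : psi3 u != 0 -> psi4 u != 0 -> psi5 u != 0 -> psi6 u != 0 ->
  ec_add 0 P (pt e5 (2 - m4 * e5)) = pt e6 (2 - m5 * e6).
Proof.
move=> n3 n4 n5 n6; apply: (add_pt (m := m5)) => //.
- by rewrite !(mulf_neq0, invr_neq0) ?natSr_neq0.
- rewrite /m4 /m5 /e5 /psi7_ker.
  rewrite /psi3 /psi4 /psi5 /psi6 in n3 n4 n5 n6 *.
  by field; rewrite ?n6 ?n5 ?n4 ?n3 ?nz3 ?nz4 ?u1_neq0 ?u_neq0 ?natSr_neq0.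
rewrite /e6 /e5 /m5 /psi7_ker /psi7_gen.
rewrite /psi3 /psi4 /psi5 /psi6 in n3 n4 n5 n6 *.
by field; rewrite ?n6 ?n5 ?n4 ?n3 ?nz3 ?nz4 ?u1_neq0 ?u_neq0 ?natSr_neq0.
Qed.

Let pt_e0 m e : e = 0 -> pt e (2 - m * e) = pt 0 2.
Proof. by move->; rewrite mulr0 subr0. Qed.

(** [psi7_gen] divides the numerator of [e6], so 6 P = - P. *)
Lemma psi7_gen_mul7_nondeg : psi7_gen u = 0 -> ec_mul 0 7 P = None.
Proof.
move=> u7; have [_ _ [n3 n4 n5 n6]] := coprime_psi7_gen u7.
rewrite /ec_mul !iterS -[ec_add 0 P (iter 0 _ _)]/P.
rewrite mul2 mul3 // mul4 // mul5 // mul6 //.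
by rewrite pt_e0 ?add_pt0 // /e6 u7 mulr0 mul0r.
Qed.

(** If psi_n(u) = 0 for some n from 3 to 6, then (n - 1) P = - P, so n P = 0 and 7 P reduces to P, 2
    P or 3 P, which is affine. Otherwise [e6] describes 6 P, and [e6 != 0] would make 7 P affine. *)
Lemma mul7_psi7_nondeg : ec_mul 0 7 P = None -> psi7_ker u * psi7_gen u = 0.
Proof.
have E0 : ec_add 0 P None = P by [].
rewrite /ec_mul !iterS -[ec_add 0 P (iter 0 _ _)]/P mul2.
have [z3 | n3] := eqVneq (psi3 u) 0.
  have z : e2 = 0 by rewrite /e2 z3 mulr0 mul0r.
  by rewrite pt_e0 // add_pt0 E0 mul2 pt_e0 // add_pt0.
rewrite mul3 //; have [z4 | n4] := eqVneq (psi4 u) 0.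
  have z : e3 = 0 by rewrite /e3 z4 mulr0 mul0r.
  by rewrite pt_e0 // add_pt0 E0 mul2 mul3.
rewrite mul4 //; have [z5 | n5] := eqVneq (psi5 u) 0.
  have z : e4 = 0 by rewrite /e4 z5 mulr0 mul0r.
  by rewrite pt_e0 // add_pt0 E0 mul2.
rewrite mul5 //; have [z6 | n6] := eqVneq (psi6 u) 0.
  have z : e5 = 0 by rewrite /e5 z6 mulr0 mul0r.
  by rewrite pt_e0 // add_pt0.
rewrite mul6 // => /eqP; have [// | n7] := eqVneq (psi7_ker u * psi7_gen u) 0.
have ne6 : e6 != 0.
  rewrite mulf_neq0 ?invr_neq0 //; first by rewrite -mulrA mulf_neq0.
  by rewrite !mulf_neq0 ?natSr_neq0.
(* [m] is whatever slope [add_pt] requires; only the affine shape of the sum matters. *)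
set m := (2 - m5 * e6) / e6.
by rewrite (add_pt (m := m) ne6 _ erefl erefl) // divfK.
Qed.

End Multiples.

(** Two degenerate values remain: u = 0 gives x = 0 and 3 P = 0, while 4 u + 1 = 0 gives y = 0 and 2
    P = 0. In both cases 7 P = P is affine. *)
Lemma mul7_psi7 (L : fieldType) (x y c u : L) : [pchar L] =i pred0 ->
  c != 0 -> x ^+ 3 = 4 * u * c -> y ^+ 2 = (4 * u + 1) * c ->
  ec_mul 0 7 (Some (x, y)) = None -> psi7_ker u * psi7_gen u = 0.
Proof.
move=> L0 c_neq0 x3 y2; have nz4 : 4 != 0 :> L by apply: natSr_neq0.
have [u0 | nu] := eqVneq u 0; last first.
  have [u1 | nu1] := eqVneq (4 * u + 1) 0; first last.
    exact: mul7_psi7_nondeg y2 nu nu1.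
  have/eqP := y2; rewrite u1 mul0r expf_eq0 => /eqP ->.
  have E2 : ec_add 0 (Some (x, 0)) (Some (x, 0)) = None.
    by rewrite /= oppr0 !eqxx.
  by rewrite /ec_mul !iterS -[ec_add 0 _ (iter 0 _ _)]/(Some (x, 0)) !E2.
have/eqP := x3; rewrite u0 mulr0 mul0r expf_eq0 => /eqP ->.
have ny : y == - y = false.
  apply: contra_neqF c_neq0; rewrite -addr_eq0 -mulr2n -mulr_natl mulf_eq0.
  rewrite (negPf (natSr_neq0 1 L0)) => /eqP y0; move: y2.
  by rewrite y0 u0 expr0n mulr0 add0r mul1r.
have E2 : ec_add 0 (Some (0, y)) (Some (0, y)) = Some (0, - y).
  by rewrite /= eqxx ny /= expr0n /= mulr0 add0r mul0r expr0n /= !subr0 mul0r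
    add0r.
have E3 : ec_add 0 (Some (0, y)) (Some (0, - y)) = None.
  by rewrite /= opprK !eqxx.
by rewrite /ec_mul !iterS -[ec_add 0 _ (iter 0 _ _)]/(Some (0, y)) !(E2, E3).
Qed.

Lemma psi7_gen_mul7 (L : fieldType) (x y c u : L) : [pchar L] =i pred0 ->
  c != 0 -> x ^+ 3 = 4 * u * c -> y ^+ 2 = (4 * u + 1) * c ->
  psi7_gen u = 0 -> ec_mul 0 7 (Some (x, y)) = None.
Proof.
move=> L0 c_neq0 x3 y2 u7; have [nu nu1 _] := coprime_psi7_gen L0 u7.
exact: psi7_gen_mul7_nondeg y2 nu nu1 u7.
Qed.

(** * The values of x^3 / (4 c) at the points of order 7 *)

Definition udelta (R : pzRingType) (w z : R) : R :=
  (33 * w + 30) * z ^+ 5 + (42 * w + 3) * z ^+ 4 + (6 * w - 15) * z ^+ 3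
  + (15 * w + 21) * z ^+ 2 + (48 * w + 24) * z + 24 * w - 13.

Lemma delta1_udelta (L : fieldType) (w z : L) : delta1 w z = 4 * udelta w z.
Proof. by rewrite /delta1 /udelta; ring. Qed.

Lemma rmorph_udelta (R S : pzRingType) (f : {rmorphism R -> S}) w z :
  f (udelta w z) = udelta (f w) (f z).
Proof.
by rewrite /udelta !(rmorph_nat, rmorphXn, rmorphM, rmorphB, rmorphD).
Qed.

Section Cyclotomic.

Variables (L : fieldType) (w z : L).
Hypothesis hw : w ^+ 2 = - w - 1.
Hypothesis hz : z ^+ 6 = - (z ^+ 5 + z ^+ 4 + z ^+ 3 + z ^+ 2 + z + 1).

Let d := udelta w z.

(* Multiplication by sqrt(-3) on the curve maps u to - (u + 1)^3 / (27 u^2). *)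
Lemma udelta_exp3 : 27 * udelta w (z ^+ 3) * d ^+ 2 = - (d + 1) ^+ 3.
Proof. by rewrite /d /udelta; ring: hw hz. Qed.

(** Pairing z^k with its inverse removes w: products and sums of pairs lie in Q(z + 1/z). The
    equations form a product type so that [rewrite] can use all three. *)
Lemma udelta_mulV :
  (udelta w z * udelta w (z ^+ 6) = 4 + 9 * (z ^+ 3 + z ^+ 4))
  * (udelta w (z ^+ 2) * udelta w (z ^+ 5) = 4 + 9 * (z + z ^+ 6))
  * (udelta w (z ^+ 3) * udelta w (z ^+ 4) = 4 + 9 * (z ^+ 2 + z ^+ 5)).
Proof. by rewrite /udelta; split; [split|]; ring: hw hz. Qed.

Lemma udelta_addV :
  (udelta w z + udelta w (z ^+ 6)
     = - 50 + 27 * (z ^+ 2 + z ^+ 5) - 36 * (z ^+ 3 + z ^+ 4))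
  * (udelta w (z ^+ 2) + udelta w (z ^+ 5)
     = - 50 + 27 * (z ^+ 3 + z ^+ 4) - 36 * (z + z ^+ 6))
  * (udelta w (z ^+ 3) + udelta w (z ^+ 4)
     = - 50 + 27 * (z + z ^+ 6) - 36 * (z ^+ 2 + z ^+ 5)).
Proof. by rewrite /udelta; split; [split|]; ring: hw hz. Qed.

(** Each difference is 1 + 2 w times a combination of z - z^6, z^2 - z^5 and z^3 - z^4; the weights
    82, 60, 39 eliminate the last two. *)
Lemma udelta_sub_span :
  82 * (udelta w z - udelta w (z ^+ 6))
  + 60 * (udelta w (z ^+ 2) - udelta w (z ^+ 5))
  + 39 * (udelta w (z ^+ 3) - udelta w (z ^+ 4))
  = 3 * 1133 * (1 + 2 * w) * (z - z ^+ 6).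
Proof. by rewrite /udelta; ring: hw hz. Qed.

Lemma psi7_ker_factor T :
  7 * psi7_ker T = (7 * T - (2 + 3 * w)) * (7 * T + (1 + 3 * w)).
Proof. by rewrite /psi7_ker; ring: hw. Qed.

Lemma psi7_gen_factor T :
  psi7_gen T = (T - udelta w z) * (T - udelta w (z ^+ 6))
    * ((T - udelta w (z ^+ 2)) * (T - udelta w (z ^+ 5)))
    * ((T - udelta w (z ^+ 3)) * (T - udelta w (z ^+ 4))).
Proof.
(* Expanding by pairs leaves an identity in T and z only, free of w. *)
have pair v v' : (T - v) * (T - v') = T ^+ 2 - (v + v') * T + v * v' by ring.
rewrite /psi7_gen !pair !udelta_addV !udelta_mulV; ring: hz.
Qed.

(* The base of the cube (resp. of the square) is 7 times the quotient of the
   x-coordinates (resp. y-coordinates) of f P and P, where f is the endomorphism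
   2 - w^2 in this lemma and 2 - w in the next one, both of norm 7. *)
Lemma psi7_ker_root1 :
  (7 + 4 * z + 5 * z ^+ 2 + 3 * z ^+ 3 + 5 * z ^+ 4 + 4 * z ^+ 5
   + w * (- z + 4 * z ^+ 2 - 6 * z ^+ 3 + 4 * z ^+ 4 - z ^+ 5)) ^+ 3 * d
    = 49 * (2 + 3 * w) /\
  (- 1 - 4 * z + 4 * z ^+ 2 - 6 * z ^+ 3
   + w * (2 - 6 * z + 6 * z ^+ 2 - 2 * z ^+ 3)) ^+ 2 * (4 * d + 1)
    = 7 * (4 * (2 + 3 * w) + 7).
Proof. by rewrite /d /udelta; split; ring: hw hz. Qed.

Lemma psi7_ker_root2 :
  (2 - 5 * z - 4 * z ^+ 3 + 4 * z ^+ 4 - 4 * z ^+ 5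
   + w * (- 1 - z - 5 * z ^+ 3 + 5 * z ^+ 4 - 5 * z ^+ 5)) ^+ 3 * d
    = 49 * - (1 + 3 * w) /\
  (5 + 2 * z + 2 * z ^+ 2 + 2 * z ^+ 3 + 6 * z ^+ 4 + 4 * z ^+ 5
   + w * (8 + 6 * z + 6 * z ^+ 2 + 6 * z ^+ 3 + 4 * z ^+ 4 + 12 * z ^+ 5)) ^+ 2
    * (4 * d + 1)
    = 7 * (4 * - (1 + 3 * w) + 7).
Proof. by rewrite /d /udelta; split; ring: hw hz. Qed.

Lemma psi7_gen_udelta : psi7_gen d = 0.
Proof. by rewrite psi7_gen_factor subrr !mul0r. Qed.

End Cyclotomic.

(** * The field generated by the 7-torsion points *)

Section Subfields.

Variables (L : fieldType) (F : L -> Prop).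
Hypothesis sF : is_subfield F.

Lemma subfield1 : F 1.
Proof. by case: sF. Qed.

Lemma subfieldB a b : F a -> F b -> F (a - b).
Proof. by case: sF => _ /(_ a b). Qed.

Lemma subfieldM a b : F a -> F b -> F (a * b).
Proof. by case: sF => _ _ /(_ a b). Qed.

Lemma subfieldV a : F a -> F a^-1.
Proof. by case: sF => _ _ _ /(_ a). Qed.

Lemma subfield0 : F 0.
Proof. by rewrite -(subrr 1); apply: subfieldB subfield1 subfield1. Qed.

Lemma subfieldN a : F a -> F (- a).
Proof. by rewrite -[- a]add0r; apply: subfieldB subfield0. Qed.

Lemma subfieldD a b : F a -> F b -> F (a + b).
Proof.
move=> Fa Fb; rewrite -[b]opprK.
by apply: subfieldB => //; apply: subfieldN.
Qed.

Lemma subfieldX a n : F a -> F (a ^+ n).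
Proof.
move=> Fa; elim: n => [|n IHn]; first exact: subfield1.
by rewrite exprS; apply: subfieldM.
Qed.

Lemma subfield_nat n : F n%:R.
Proof.
elim: n => [|n IHn]; first exact: subfield0.
by rewrite -natr1; apply: subfieldD subfield1.
Qed.

Lemma subfield_cancelM a b : a != 0 -> F a -> F (a * b) -> F b.
Proof.
by move=> nz_a Fa Fab; rewrite -(mulKf nz_a b);
  apply: subfieldM => //; apply: subfieldV.
Qed.

End Subfields.

Ltac in_subfield :=
  repeat first
    [ assumption | apply: subfield1 | apply: subfield0 | apply: subfield_nat
    | apply: subfieldN | apply: subfieldD | apply: subfieldM | apply: subfieldV
    | apply: subfieldX ].

Lemma subfield_udelta (L : fieldType) (F : L -> Prop) w z c : is_subfield F ->
  F w -> F z -> F c -> F (4 * udelta w z * c) /\ F ((4 * udelta w z + 1) * c).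
Proof. by move=> sF Fw Fz Fc; split; in_subfield. Qed.

Lemma adjoin_subfield (L : fieldType) (E S : L -> Prop) :
  is_subfield (adjoin E S).
Proof.
split=> [F sF _ _ | a b Fa Fb F sF EF SF | a b Fa Fb F sF EF SF
  | a Fa F sF EF SF].
- exact: subfield1.
- by apply: subfieldB; [|apply: Fa|apply: Fb].
- by apply: subfieldM; [|apply: Fa|apply: Fb].
- by apply: subfieldV; [|apply: Fa].
Qed.

Lemma sub_adjoin (L : fieldType) (E S : L -> Prop) a : E a -> adjoin E S a.
Proof. by move=> Ea F _ EF _; apply: EF. Qed.

Lemma mem_adjoin (L : fieldType) (E S : L -> Prop) a : S a -> adjoin E S a.
Proof. by move=> Sa F _ _ SF; apply: SF. Qed.

Lemma mem_adjoin_seq (L : fieldType) (E : L -> Prop) (S : seq L) a :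
  a \in S -> adjoin_seq E S a.
Proof. by move=> Sa F _ _ SF; apply: SF. Qed.

Lemma expf_eq2 (L : fieldType) (a b : L) : a ^+ 2 = b ^+ 2 -> a = b \/ a = - b.
Proof. by move/eqP; rewrite eqf_sqr => /orP[] /eqP; [left | right]. Qed.

Lemma expf_eq3 (L : fieldType) (w a b : L) : w ^+ 2 = - w - 1 ->
  a ^+ 3 = b ^+ 3 -> [\/ a = b, a = w * b | a = w ^+ 2 * b].
Proof.
move=> hw ab; have : (a - b) * ((a - w * b) * (a - w ^+ 2 * b)) = 0.
  by rewrite -[RHS](subrr (b ^+ 3)) -{1}ab; ring: hw.
move/eqP; rewrite !mulf_eq0 !subr_eq0 => /or3P[] /eqP;
  by [constructor 1 | constructor 2 | constructor 3].
Qed.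

Lemma exists_root (L : closedFieldType) n (a : L) : (0 < n)%N ->
  exists b, b ^+ n = a.
Proof.
case: n => // n _.
have [b Db] := solve_monicpoly (fun i => if i is 0%N then a else 0) (ltn0Sn n).
exists b; rewrite Db big_ord_recl expr0 mulr1 big1 ?addr0 // => i _.
by rewrite lift0 mul0r.
Qed.

Lemma prim3_root (L : fieldType) (w : L) : 3.-primitive_root w ->
  w ^+ 2 = - w - 1.
Proof.
move=> w_prim; have nw : w - 1 != 0.
  by rewrite subr_eq0 -[w]expr1 -(prim_order_dvd w_prim).
apply: (mulfI nw); apply/eqP; rewrite -subr_eq0.
have -> : (w - 1) * w ^+ 2 - (w - 1) * (- w - 1) = w ^+ 3 - 1 by ring.
by rewrite (prim_expr_order w_prim) subrr.
Qed.

Lemma prim7_root (L : fieldType) (z : L) : 7.-primitive_root z ->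
  z ^+ 6 = - (z ^+ 5 + z ^+ 4 + z ^+ 3 + z ^+ 2 + z + 1).
Proof.
move=> z_prim; have nz : z - 1 != 0.
  by rewrite subr_eq0 -[z]expr1 -(prim_order_dvd z_prim).
apply: (mulfI nz); apply/eqP; rewrite -subr_eq0.
rewrite [X in X == 0](_ : _ = z ^+ 7 - 1); last by ring.
by rewrite (prim_expr_order z_prim) subrr.
Qed.

(** * Coordinates of the points of order 7 and the generators w, z, r, s *)

Section TorsionField.

Variables (L : closedFieldType) (E : L -> Prop) (c w z r s : L).
Hypotheses (L0 : [pchar L] =i pred0) (Ec : E c) (c_neq0 : c != 0).
Hypotheses (w_prim : 3.-primitive_root w) (z_prim : 7.-primitive_root z).
Hypothesis r3 : r ^+ 3 = 4 * udelta w z * c.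
Hypothesis s2 : s ^+ 2 = (4 * udelta w z + 1) * c.

Let hw := prim3_root w_prim.
Let hz := prim7_root z_prim.
Let nz4 : 4 != 0 :> L. Proof. exact: natSr_neq0. Qed.
Let nz7 : 7 != 0 :> L. Proof. exact: natSr_neq0. Qed.

Definition has_point (F : L -> Prop) (u : L) : Prop :=
  exists x y, [/\ F x, F y, x ^+ 3 = 4 * u * c & y ^+ 2 = (4 * u + 1) * c].

Let z_primX k : coprime k 7 -> 7.-primitive_root (z ^+ k).
Proof. by rewrite prim_root_exp_coprime. Qed.

(** Points above the same u have abscissas differing by a power of w and ordinates by a sign, so one
    point over F puts all of them over F. *)
Lemma has_point_mem F u x y : is_subfield F -> F w -> has_point F u ->
  x ^+ 3 = 4 * u * c -> y ^+ 2 = (4 * u + 1) * c -> F x /\ F y.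
Proof.
move=> sF Fw [x0 [y0 [Fx0 Fy0 <- <-]]] /(expf_eq3 hw)x3 /expf_eq2 y2.
by split; [case: x3 => -> | case: y2 => ->]; in_subfield.
Qed.

(** The hypotheses say (a / 7)^3 d = u and (b / 7)^2 (4 d + 1) = 4 u + 1, so (a x / 7, b y / 7) lies
    above u. *)
Lemma has_point_scale F d u v a b : is_subfield F -> has_point F d -> F a ->
  F b -> 7 * u = v -> a ^+ 3 * d = 49 * v ->
  b ^+ 2 * (4 * d + 1) = 7 * (4 * v + 7) -> has_point F u.
Proof.
move=> sF [x [y [Fx Fy x3 y2]]] Fa Fb <- a3 b2.
exists (a / 7 * x), (b / 7 * y); split; [by in_subfield | by in_subfield | |].
  rewrite exprMn x3; transitivity (4 * c * (a ^+ 3 * d) / 7 ^+ 3).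
    by field; rewrite natSr_neq0.
  by rewrite a3; field; rewrite natSr_neq0.
rewrite exprMn y2; transitivity (c * (b ^+ 2 * (4 * d + 1)) / 7 ^+ 2).
  by field; rewrite natSr_neq0.
by rewrite b2; field; rewrite natSr_neq0.
Qed.

Lemma has_point_exp3 F v : is_subfield F -> F w -> F v -> 7.-primitive_root v ->
  has_point F (udelta w v) -> has_point F (udelta w (v ^+ 3)).
Proof.
move=> sF Fw Fv /prim7_root hv [x [y [Fx Fy x3 y2]]].
have d3 := udelta_exp3 hw hv.
have [nd _ _] := coprime_psi7_gen L0 (psi7_gen_udelta hw hv).
have Fd : F (udelta w v) by rewrite /udelta; in_subfield.
have nz3 : 3 != 0 :> L by apply: natSr_neq0.
have nw : 1 + 2 * w != 0.
  apply: contra_neq nz3 => w0; have -> : 3 = - (1 + 2 * w) ^+ 2 by ring: hw.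
  by rewrite w0 expr0n oppr0.
move: d3 Fd nd x3 y2; move: (udelta w v) (udelta w (v ^+ 3)) =>
  d e d3 Fd nd x3 y2.
have {}d3 : e = - (d + 1) ^+ 3 / (27 * d ^+ 2).
  have nz : 27 * d ^+ 2 != 0 by rewrite mulf_neq0 ?expf_neq0 ?natSr_neq0.
  by apply: (mulIf nz); rewrite divfK // -d3; ring.
(* The image of (x, y) under an endomorphism of square -3; [1 + 2 * w] is a square root of -3 in
   F. *)
exists (- (d + 1) / (3 * d) * x), ((d - 2) / (3 * (1 + 2 * w) * d) * y).
split; [by in_subfield | by in_subfield | |].
- by rewrite exprMn x3 d3; field; rewrite nd nz3 ?natSr_neq0.
rewrite exprMn y2 expr_div_n !exprMn.
have -> : (1 + 2 * w) ^+ 2 = - 3 by ring: hw.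
by rewrite d3; field; rewrite nd ?natSr_neq0 // oppr_eq0 natSr_neq0.
Qed.

Lemma torsion_mem F x y : is_subfield F -> (forall a, E a -> F a) ->
  F w -> F z -> F r -> F s -> ec_torsion 0 c 7 (Some (x, y)) -> F x /\ F y.
Proof.
move=> sF EF Fw Fz Fr Fs [/= onE P7]; pose u := x ^+ 3 / (4 * c).
have x3 : x ^+ 3 = 4 * u * c by rewrite /u; field; rewrite c_neq0.
have y2 : y ^+ 2 = (4 * u + 1) * c by rewrite onE mul0r addr0 x3; ring.
have pt1 : has_point F (udelta w z) by exists r, s.
have step k : coprime k 7 -> has_point F (udelta w (z ^+ k)) ->
    has_point F (udelta w (z ^+ (k * 3))).
  by move=> k7; rewrite exprM; apply: has_point_exp3;
    [| | apply: subfieldX | apply: z_primX].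
have z7 := prim_expr_order z_prim.
have red k m : z ^+ (k + 7 * m) = z ^+ k by rewrite exprD exprM z7 expr1n mulr1.
(* 3 generates the units modulo 7: repeated cubing visits the exponents 1, 3, 2, 6, 4, 5, and [red]
   reduces them modulo 7. *)
have pt3 : has_point F (udelta w (z ^+ 3)) by apply: (step 1%N).
have pt2 : has_point F (udelta w (z ^+ 2)) by rewrite -(red 2%N 1%N);
  apply: (step 3%N).
have pt6 : has_point F (udelta w (z ^+ 6)) by apply: (step 2%N).
have pt4 : has_point F (udelta w (z ^+ 4)) by rewrite -(red 4%N 2%N);
  apply: (step 6%N).
have pt5 : has_point F (udelta w (z ^+ 5)) by rewrite -(red 5%N 1%N);
  apply: (step 4%N).
apply: (has_point_mem (u := u)) => //.
have := mul7_psi7 L0 c_neq0 x3 y2 P7; move/eqP;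
  rewrite mulf_eq0 => /orP[] /eqP u7.
  move/(congr1 ( *%R 7)): u7; rewrite mulr0 (psi7_ker_factor hw) => /eqP.
  rewrite mulf_eq0 subr_eq0 addr_eq0 => /orP[] /eqP Du.
    have [a3 b2] := psi7_ker_root1 hw hz.
    by apply: (has_point_scale sF pt1 _ _ Du a3 b2); in_subfield.
  have [a3 b2] := psi7_ker_root2 hw hz.
  by apply: (has_point_scale sF pt1 _ _ Du a3 b2); in_subfield.
move/eqP: u7; rewrite (psi7_gen_factor hw hz) !mulf_eq0 !subr_eq0.
by move=> /orP[/orP[]|] /orP[] /eqP->.
Qed.

(** Points above each conjugate of [udelta w z] exist since L is closed, and 7 kills them. So F
    contains w, the quotient of the abscissas w r and r, and all conjugates of [udelta w z], from
    which z is recovered. *)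
Lemma torsion_coord_gen F : is_subfield F -> F c ->
  (forall a, torsion_coord 0 c 7 a -> F a) -> [/\ F w, F z, F r & F s].
Proof.
move=> sF Fc FT.
have tors k x y : coprime k 7 -> x ^+ 3 = 4 * udelta w (z ^+ k) * c ->
    y ^+ 2 = (4 * udelta w (z ^+ k) + 1) * c -> F x /\ F y.
  move=> /z_primX/prim7_root hzk x3 y2.
  have tor : ec_torsion 0 c 7 (Some (x, y)).
    split; first by rewrite /= mul0r addr0 y2 x3; ring.
    exact: psi7_gen_mul7 L0 c_neq0 x3 y2 (psi7_gen_udelta hw hzk).
  by split; apply: FT; exists x, y; split=> //; [left | right].
have Fd k : coprime k 7 -> F (udelta w (z ^+ k)).
  move=> k7; have [x x3] := exists_root (4 * udelta w (z ^+ k) * c) (isT :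
    0 < 3)%N.
  have [y y2] := exists_root ((4 * udelta w (z ^+ k) + 1) * c) (isT : 0 < 2)%N.
  have [Fx _] := tors k x y k7 x3 y2.
  have -> : udelta w (z ^+ k) = x ^+ 3 / (4 * c) by rewrite x3;
    field; rewrite c_neq0.
  by in_subfield.
have [Fr Fs] := tors 1%N r s isT r3 s2.
have [nd _ _] := coprime_psi7_gen L0 (psi7_gen_udelta hw hz).
have nr : r != 0.
  apply: contraTneq (mulf_neq0 (mulf_neq0 nz4 nd) c_neq0) => r0.
  by rewrite -r3 r0 expr0n eqxx.
have Fw : F w.
  apply: (subfield_cancelM sF nr) => //; rewrite mulrC.
  have wr3 : (w * r) ^+ 3 = 4 * udelta w (z ^+ 1) * c.
    by rewrite exprMn (prim_expr_order w_prim) mul1r.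
  by have [] := tors 1%N _ _ isT wr3 s2.
have Fz : F z.
  have nz3 : 3 != 0 :> L by apply: natSr_neq0.
  have nw : 1 + 2 * w != 0.
    apply: contra_neq nz3 => w0; have -> : 3 = - (1 + 2 * w) ^+ 2 by ring: hw.
    by rewrite w0 expr0n oppr0.
  (* A product of two conjugates gives z + z^6, their differences give z - z^6, and z is half the
     sum. *)
  have Fadd : F (z + z ^+ 6).
    apply: (subfield_cancelM sF (natSr_neq0 8 L0)); first by in_subfield.
    have -> : 9 * (z + z ^+ 6) = udelta w (z ^+ 2) * udelta w (z ^+ 5) - 4.
      by rewrite udelta_mulV //; ring.
    by apply: subfieldB => //; [apply: subfieldM => //;
      apply: Fd | in_subfield].
  have Fsub : F (z - z ^+ 6).
    have n3 : 3 * 1133 * (1 + 2 * w) != 0 by rewrite !mulf_neq0 ?natSr_neq0.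
    apply: (subfield_cancelM sF n3); first by in_subfield.
    have F1 : F (udelta w z) := Fd 1%N isT.
    have [F2 F3] := (Fd 2%N isT, Fd 3%N isT).
    have [F4 F5 F6] := And3 (Fd 4%N isT) (Fd 5%N isT) (Fd 6%N isT).
    by rewrite -udelta_sub_span //; in_subfield.
  apply: (subfield_cancelM sF (natSr_neq0 1 L0)); first by in_subfield.
  have -> : 2 * z = (z + z ^+ 6) + (z - z ^+ 6) by ring.
  exact: subfieldD.
by split.
Qed.

Lemma torsion_field_gen v :
  torsion_field E 0 c 7 v <-> adjoin_seq E [:: w; z; r; s] v.
Proof.
split; apply.
- exact: adjoin_subfield.
- by move=> a; apply: sub_adjoin.
- move=> a [x [y [tor xy]]]; set F := adjoin_seq _ _.
  have sF : is_subfield F by apply: adjoin_subfield.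
  suff [] : F x /\ F y by case: xy => ->.
  have FS b : b \in [:: w; z; r; s] -> F b by apply: mem_adjoin_seq.
  apply: (torsion_mem sF) (FS w _) (FS z _) (FS r _) (FS s _) tor.
    by move=> b; apply: sub_adjoin.
  1-4: by rewrite !inE eqxx ?orbT.
- exact: adjoin_subfield.
- by move=> a; apply: sub_adjoin.
have [Tw Tz Tr Ts] := torsion_coord_gen
  (@adjoin_subfield _ E (torsion_coord 0 c 7)) (sub_adjoin Ec)
  (@mem_adjoin _ _ _).
by move=> a; rewrite !inE => /or4P[] /eqP->.
Qed.

End TorsionField.

(** * Degrees *)

Section AdjoinDegree.

Variables (K : fieldType) (M : fieldExtType K) (U : {subfield M}) (x : M).

Let deg_gt0 : (0 < adjoin_degree U x)%N.
Proof.
rewrite -ltnS -size_minPoly; apply: root_size_gt1 (root_minPoly U x).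
by rewrite -size_poly_eq0 size_minPoly.
Qed.

Let deg_le (q : {poly M}) : q \is a polyOver U -> q != 0 -> root q x ->
  (adjoin_degree U x < size q)%N.
Proof.
by move=> Uq nz_q qx0; rewrite -size_minPoly dvdp_leq ?minPoly_dvdp.
Qed.

Lemma dim_adjoin_quadratic a b : a \in U -> b \in U -> x ^+ 2 = a * x + b ->
  \dim <<U; x>> = (2 ^ (x \notin U) * \dim U)%N.
Proof.
move=> Ua Ub x2; rewrite dim_Fadjoin; congr (_ * _)%N.
have : (adjoin_degree U x < 3)%N.
  have sz : size ('X^2 - (a *: 'X + b%:P)) = 3%N.
    rewrite size_polyDl size_polyXn // size_polyN.
    rewrite (leq_ltn_trans (size_polyD _ _)) //.
    rewrite gtn_max (leq_ltn_trans (size_scale_leq _ _)) ?size_polyX //.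
    by rewrite (leq_ltn_trans (size_polyC_leq1 _)).
  rewrite -sz; apply: deg_le.
  - by rewrite rpredB ?rpredX ?polyOverX // rpredD ?polyOverC ?polyOverZ
    ?polyOverX.
  - by rewrite -size_poly_eq0 sz.
  - by rewrite /root !hornerE x2 subrr.
rewrite -adjoin_deg_eq1.
by case: (adjoin_degree U x) deg_gt0 => [|[|[|]]].
Qed.

(** Degree 2 is impossible: the cofactor of the minimal polynomial in the cubic would be linear,
    with a root in U, which forces x into U. *)
Lemma dim_adjoin_cubic a b c : a \in U -> b \in U -> c \in U ->
  x ^+ 3 = a * x ^+ 2 + b * x + c ->
  (forall y, y \in U -> y ^+ 3 = a * y ^+ 2 + b * y + c -> x \in U) ->
  \dim <<U; x>> = (3 ^ (x \notin U) * \dim U)%N.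
Proof.
move=> Ua Ub Uc x3 Ux; rewrite dim_Fadjoin; congr (_ * _)%N.
pose q : {poly M} := 'X^3 - (a *: 'X^2 + b *: 'X + c%:P).
have qE y : q.[y] = y ^+ 3 - (a * y ^+ 2 + b * y + c) by rewrite !hornerE.
have sz : size q = 4%N.
  rewrite size_polyDl size_polyXn // size_polyN.
  have sXY (p1 p2 : {poly M}) : (size p1 < 4)%N -> (size p2 < 4)%N ->
      (size (p1 + p2)%R < 4)%N.
    by move=> s1 s2; rewrite (leq_ltn_trans (size_polyD _ _)) // gtn_max s1.
  rewrite !sXY ?(leq_ltn_trans (size_scale_leq _ _)) ?size_polyXn
    ?size_polyX //.
  by rewrite (leq_ltn_trans (size_polyC_leq1 _)).
have Uq : q \is a polyOver U.
  by rewrite rpredB ?rpredX ?polyOverX // !rpredD ?polyOverC ?polyOverZ ?rpredX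
    ?polyOverX.
have nz_q : q != 0 by rewrite -size_poly_eq0 sz.
have qx0 : root q x by rewrite /root qE x3 subrr.
have := deg_le Uq nz_q qx0; rewrite sz -adjoin_deg_eq1.
case Dn : (adjoin_degree U x) deg_gt0 => [|[|[|[|]]]] // _ _.
have dv := minPoly_dvdp Uq qx0.
have szl : size (q %/ minPoly U x) = 2%N.
  by rewrite size_divp -?size_poly_eq0 ?size_minPoly // sz Dn.
have Ul : q %/ minPoly U x \is a polyOver U
  by rewrite divp_polyOver ?minPolyOver.
have := divpK dv; move: Ul szl; move: (q %/ _) => l /polyOverP Ul szl Dq.
have nl : l`_1 != 0.
  by move: (lead_coef_eq0 l); rewrite lead_coefE szl -size_poly_eq0 szl => ->.
have ly : root l (- (l`_0 / l`_1)).
  rewrite /root horner_coef szl !big_ord_recl big_ord0 /= expr0 expr1 mulr1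
    addr0.
  by rewrite mulrN mulrCA mulfV // mulr1 subrr.
have Uy : - (l`_0 / l`_1) \in U by rewrite rpredN rpred_div.
suff: x \in U by rewrite -adjoin_deg_eq1 Dn.
apply: Ux Uy _; apply/eqP; rewrite -subr_eq0 -qE -Dq.
by rewrite hornerM (rootP ly) mul0r.
Qed.

End AdjoinDegree.

(** * Finite extensions of K inside its algebraic closure *)

Section Embedding.

Variables (K : fieldType) (L : closedFieldType) (iota : {rmorphism K -> L}).
Hypothesis K0 : [pchar K] =i pred0.
Hypothesis L_alg : forall z : L, algebraicOver iota z.

(** A nonzero annihilating polynomial of least size is irreducible; excluded middle decides whether
    a smaller one exists. *)
Lemma exists_irreducible_poly (z : L) :
  exists2 p, root (map_poly iota p) z & irreducible_poly p.
Proof.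
have [p0 nz_p0 p0z] := L_alg z.
have [n] := ubnP (size p0); elim: n p0 nz_p0 p0z =>
  // n IHn p0 nz_p0 p0z lt_p0n.
have [min_p | not_min] := classic (forall q, root (map_poly iota q) z ->
  q != 0 ->
    (size p0 <= size q)%N).
  by exists p0 => //; apply/(subfx_irreducibleP p0z nz_p0).
have [q not_q] := not_all_ex_not _ _ not_min.
have [qz not_q'] := imply_to_and _ _ not_q.
have [nz_q /negP] := imply_to_and _ _ not_q'; rewrite -ltnNge => lt_qp.
by apply: (IHn q) => //; apply: leq_trans lt_qp _; rewrite -ltnS.
Qed.

(** The primitive element theorem, one generator at a time: x and z are both polynomials in
    [x *+ n - z]. *)
Lemma exists_primitive_element (S : seq L) :
  exists z, forall x, x \in S -> exists p, x = (map_poly iota p).[z].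
Proof.
elim: S => [|x S [z genz]]; first by exists 0.
have [p nz_p pz0] := L_alg z; have [q nz_q qx0] := L_alg x.
have [n [[pz Dz] [px Dx]]] := pchar0_PET nz_p pz0 nz_q qx0 K0.
exists (x *+ n - z) => y; rewrite inE => /predU1P[-> | /genz[py Dy]].
  by exists px.
by exists (py \Po pz); rewrite map_comp_poly horner_comp Dz.
Qed.

(** This moves the question into a finite-dimensional M, where subfields are subspaces with a
    dimension; M is K[X] modulo an irreducible polynomial of a primitive element. *)
Lemma exists_finite_extension (S : seq L) :
  exists (M : fieldExtType K) (phi : {rmorphism M -> L}) (S' : seq M),
    (forall a, phi a%:A = iota a) /\ S = map phi S'.
Proof.
have [z genz] := exists_primitive_element S.
have [p pz0 irr_p] := exists_irreducible_poly z.
have nz_p := irredp_neq0 irr_p.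
pose M : fieldExtType K := SubFieldExtType pz0 irr_p.
pose phi : {rmorphism M -> L} := @subfx_inj _ _ iota z p.
exists M, phi.
have phiK a : phi a%:A = iota a by apply: subfx_inj_base.
suff [S' ->] : exists S', S = map phi S' by exists S'.
elim: S genz => [|x S IHS] genz; first by exists [::].
have [S' ->] : exists S', S = map phi S'.
  by apply: IHS => y Sy; apply: genz; rewrite inE Sy orbT.
have [q ->] := genz x (mem_head _ _).
by exists (subfx_eval iota z p q :: S'); rewrite /= /phi subfx_inj_eval.
Qed.

End Embedding.

(** * Subspaces of a finite extension as predicates on L *)

Section Image.

Variables (K L : fieldType) (iota : {rmorphism K -> L}).
Variables (M : fieldExtType K) (phi : {rmorphism M -> L}).
Hypothesis phiK : forall a, phi a%:A = iota a.

Definition vspace_image (U : {vspace M}) : L -> Prop :=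
  fun v => exists2 x, x \in U & v = phi x.

Lemma mem_vspace_image (U : {vspace M}) x : vspace_image U (phi x) <-> x \in U.
Proof.
by split=> [[y Uy /fmorph_inj->] | Ux] //; exists x.
Qed.

Lemma vspace_image_subfield (U : {subfield M}) : is_subfield (vspace_image U).
Proof.
split=> [|_ _ [x Ux ->] [y Uy ->]|_ _ [x Ux ->] [y Uy ->]|_ [x Ux ->]].
- by exists 1; rewrite ?rpred1 ?rmorph1.
- by exists (x - y); rewrite ?rpredB ?rmorphB.
- by exists (x * y); rewrite ?rpredM ?rmorphM.
- by exists x^-1; rewrite ?rpredV ?fmorphV.
Qed.

Lemma vspace_image1 v : vspace_image 1 v <-> field_image iota v.
Proof.
split=> [[_ /vlineP[a ->] ->] | [a ->]]; first by exists a.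
by exists a%:A; rewrite ?phiK // memvZ ?mem1v.
Qed.

Lemma vspace_image_adjoin (U : {subfield M}) x (F : L ->
  Prop) : is_subfield F ->
  (forall v, vspace_image U v -> F v) -> F (phi x) ->
  forall v, vspace_image <<U; x>> v -> F v.
Proof.
move=> sF UF Fx _ [y /Fadjoin_polyP[p /polyOverP Up ->] ->].
rewrite horner_coef rmorph_sum; apply: (big_ind F).
- exact: subfield0.
- exact: subfieldD.
move=> i _; rewrite rmorphM rmorphXn; apply: subfieldM => //.
  by apply/UF/mem_vspace_image.
exact: subfieldX.
Qed.

Lemma adjoin_seq_image (S : seq M) v :
  adjoin_seq (field_image iota) (map phi S) v <-> vspace_image <<1 & S>> v.
Proof.
split=> [|vS F sF KF SF].
  apply; first exact: vspace_image_subfield.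
    move=> _ /vspace_image1[x Kx ->]; apply/mem_vspace_image.
    exact: subvP (subv_adjoin_seq _ _) _ Kx.
  by move=> _ /mapP[x Sx ->]; apply/mem_vspace_image/seqv_sub_adjoin.
(* The base field is generalized from K to any subfield of M, for the induction on S. *)
have: forall u, vspace_image 1%AS u -> F u by move=> u /vspace_image1/KF.
move: vS SF; rewrite -[1%VS]/(1%AS : {vspace M}); move: 1%AS.
elim: S v => [|x S IHS] v U.
  by rewrite adjoin_nil subfield_closed => Uv _; apply.
rewrite adjoin_cons => vS SF UF; apply: (IHS _ <<U; x>>%AS) => //.
  by move=> y Sy; apply: SF; rewrite inE Sy orbT.
by apply: vspace_image_adjoin => //; apply: SF; rewrite inE eqxx.
Qed.

Lemma image_scale a x : phi (a *: x) = iota a * phi x.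
Proof. by rewrite -mulr_algl rmorphM phiK. Qed.

(** Existence and uniqueness of expansions make [e] the image of a basis of U, which forces its
    length. *)
Lemma has_degree_image (U : {vspace M}) d :
  has_degree (field_image iota) (vspace_image U) d <-> d = \dim U.
Proof.
split=> [[e [Ue basis_e]] | ->].
  have /fin_all_exists[e' De] i : exists x, x \in U /\ e i = phi x.
    by have [x] := Ue i; exists x.
  pose X := [tuple e' i | i < d]; have XE (i : 'I_d) : X`_i = e' i 
    by rewrite -tnth_nth tnth_mktuple.
  have sumE (k : 'I_d -> K) : phi (\sum_(i < d) k i *: X`_i) = \sum_(i < d)
    iota (k i) * e i.
    by rewrite rmorph_sum; apply: eq_bigr => i _;
      rewrite image_scale XE (De i).2.
  suff /size_basis-> : basis_of U X by [].
  apply/andP; split.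
    rewrite eqEsubv; apply/andP; split.
      by apply/span_subvP=> _ /mapP[i _ ->]; case: (De i).
    apply/subvP=> x Ux; have [|a [[Ka Dx] _]] := basis_e (phi x).
      by exists x.
    have [k Dk] := fin_all_exists Ka.
    have -> : x = \sum_(i < d) k i *: X`_i.
      by apply: (fmorph_inj phi); rewrite sumE Dx;
        apply: eq_bigr => i _; rewrite Dk.
    by apply: rpred_sum => i _; rewrite rpredZ // memv_span ?mem_nth
      ?size_tuple.
  apply/freeP=> k k0 i; have [|a [_ uniq_a]] := basis_e 0.
    by exists 0; rewrite ?mem0v ?rmorph0.
  have Da : a = [ffun j => iota (k j)].
    apply: uniq_a; split=> [j|]; first by rewrite ffunE; exists (k j).
    under eq_bigr do rewrite ffunE.
    by rewrite -sumE k0 rmorph0.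
  have : a = [ffun => 0].
    apply: uniq_a; split=> [j|]; first by rewrite ffunE;
      exists 0; rewrite rmorph0.
    by rewrite big1 // => j _; rewrite ffunE mul0r.
  rewrite Da => /ffunP/(_ i); rewrite !ffunE => /eqP.
  by rewrite fmorph_eq0 => /eqP.
have sumE (k : 'I_(\dim U) -> K) :
    phi (\sum_(i < \dim U) k i *: (vbasis U)`_i)
      = \sum_(i < \dim U) iota (k i) * phi (vbasis U)`_i.
  by rewrite rmorph_sum; apply: eq_bigr => i _; rewrite image_scale.
exists (fun i => phi (vbasis U)`_i); split=> [i | _ [x Ux ->]].
  by apply/mem_vspace_image; rewrite vbasis_mem ?mem_nth ?size_tuple.
exists [ffun i => iota (coord (vbasis U) i x)]; split.
  split=> [i|]; first by rewrite ffunE; exists (coord (vbasis U) i x).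
  rewrite {1}(coord_vbasis Ux) sumE.
  by apply: eq_bigr => i _; rewrite ffunE.
move=> a [Ka Dx]; have [k Dk] := fin_all_exists Ka.
apply/ffunP=> i; rewrite ffunE Dk; congr (iota _).
have -> : x = \sum_(j < \dim U) k j *: (vbasis U)`_j.
  by apply: (fmorph_inj phi); rewrite sumE Dx;
    apply: eq_bigr => j _; rewrite Dk.
by rewrite coord_sum_free // (basis_free (vbasisP U)).
Qed.

End Image.

(** * The five steps of the tower *)

Section Tower.

Variables (K : fieldType) (M : fieldExtType K) (w z r s : M).
Hypothesis hw : w ^+ 2 = - w - 1.
Hypothesis hz : z ^+ 6 = - (z ^+ 5 + z ^+ 4 + z ^+ 3 + z ^+ 2 + z + 1).

Let t := z + z^-1.
Let z7 : z * z ^+ 6 = 1. Proof. by ring: hz. Qed.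
Let z_neq0 : z != 0.
Proof. by apply: contra_eq_neq z7 => ->; rewrite mul0r eq_sym oner_neq0. Qed.
Let tE : t = z + z ^+ 6.
Proof. by rewrite /t; congr (_ + _); apply: (mulfI z_neq0);
  rewrite z7 mulfV. Qed.

Lemma dim_tower : r ^+ 3 \in <<1 & [:: w; z]>>%VS ->
  s ^+ 2 \in <<1 & [:: w; z]>>%VS ->
  \dim <<1 & [:: w; z; r; s]>>
    = (2 ^ (s \notin <<1 & [:: w; z]>>%VS)
       * (3 ^ (r \notin <<1 & [:: w; z]>>%VS)
       * (2 ^ (z \notin <<1 & [:: w; t]>>%VS)
       * (3 ^ (t \notin <<1 & [:: w]>>%VS) * 2 ^ (w \notin 1%VS)))))%N.
Proof.
pose Fw := <<1; w>>%AS; pose Ft := <<Fw; t>>%AS; pose Fz := <<Ft; z>>%AS.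
pose Fr := <<Fz; r>>%AS.
have DFw : <<1 & [:: w]>>%VS = Fw by rewrite adjoin_seq1.
have DFt : <<1 & [:: w; t]>>%VS = Ft by rewrite adjoin_cons adjoin_seq1.
have DFz : <<1 & [:: w; z]>>%VS = Fz.
  rewrite adjoin_cons adjoin_seq1; apply/eqP;
    rewrite eqEsubv; apply/andP; split.
    apply/FadjoinP; split; last exact: memv_adjoin.
    by apply: subv_trans (subv_adjoin _ _); apply: subv_adjoin.
  apply/FadjoinP; split; last exact: memv_adjoin.
  apply/FadjoinP; split; first exact: subv_adjoin.
  by rewrite tE rpredD ?rpredX ?memv_adjoin.
have DFr : <<1 & [:: w; z; r; s]>>%VS = <<Fr; s>>%VS.
  rewrite !adjoin_cons adjoin_nil subfield_closed.
  by congr (<< <<_; _>>; _>>)%VS; rewrite -DFz adjoin_cons adjoin_seq1.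
rewrite DFw DFt DFr !DFz => r3 s2.
have wFz : w \in Fz.
  apply: (subvP (subv_adjoin _ _)); apply: (subvP (subv_adjoin _ _)).
  exact: memv_adjoin.
have dimw : \dim Fw = (2 ^ (w \notin 1%VS))%N.
  rewrite (@dim_adjoin_quadratic _ _ 1%AS w (- 1) (- 1)) ?rpredN ?rpred1 //.
    by rewrite dimv1 muln1.
  by rewrite hw; ring.
have dimt : \dim Ft = (3 ^ (t \notin Fw) * \dim Fw)%N.
  have t3 : t ^+ 3 = - 1 * t ^+ 2 + 2 * t + 1 by rewrite tE; ring: hz.
  apply: (dim_adjoin_cubic _ _ _ t3); rewrite ?rpredN ?rpred_nat ?rpred1 //.
  move=> y Uy y3; have {}y3 : y ^+ 3 = - y ^+ 2 + 2 * y + 1 by rewrite y3; ring.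
  have {}t3 : t ^+ 3 = - t ^+ 2 + 2 * t + 1 by rewrite t3; ring.
  (* If y = z + 1/z, then y^2 - 2 and y^3 - 3 y are the same expression in z^2 and z^3: any root of
     the cubic yields the other two. *)
  have : (t - y) * ((t - (y ^+ 2 - 2)) * (t - (y ^+ 3 - 3 * y))) = 0
    by ring: y3 t3.
  move/eqP; rewrite !mulf_eq0 !subr_eq0 => /or3P[] /eqP-> //.
    by rewrite rpredB ?rpredX ?rpred_nat.
  by rewrite rpredB ?rpredX ?rpredM ?rpred_nat.
have dimz : \dim Fz = (2 ^ (z \notin Ft) * \dim Ft)%N.
  apply: (dim_adjoin_quadratic (a := t) (b := - 1));
    rewrite ?memv_adjoin ?rpredN ?rpred1 //.
  by rewrite /t; field.
have dimr : \dim Fr = (3 ^ (r \notin Fz) * \dim Fz)%N.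
  apply: (dim_adjoin_cubic (a := 0) (b := 0) (c := r ^+ 3)); rewrite ?rpred0 //.
    by rewrite !mul0r !add0r.
  move=> y Uy; rewrite !mul0r !add0r => /esym/(expf_eq3 hw) [] -> //.
    by rewrite rpredM.
  by rewrite rpredM ?rpredX.
have dims : \dim <<Fr; s>> = (2 ^ (s \notin Fr) * \dim Fr)%N.
  apply: (dim_adjoin_quadratic (a := 0) (b := s ^+ 2)); rewrite ?rpred0 //.
    exact: subvP (subv_adjoin _ _) _ s2.
  by rewrite mul0r add0r.
have dims' : \dim <<Fz; s>> = (2 ^ (s \notin Fz) * \dim Fz)%N.
  apply: (dim_adjoin_quadratic (a := 0) (b := s ^+ 2)); rewrite ?rpred0 //.
  by rewrite mul0r add0r.
(* The degree of Fr over Fz is odd, so s cannot enter at that step. *)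
have Ds : (s \in Fr) = (s \in Fz).
  apply/idP/idP; last exact: subvP (subv_adjoin _ _) s.
  apply: contraTT => sFz; apply/negP => sFr.
  have /field_dimS : (<<Fz; s>>%AS <= Fr)%VS.
    by apply/FadjoinP; split=> //; apply: subv_adjoin.
  rewrite dims' dimr sFz dvdn_pmul2r ?adim_gt0 //.
  by case: (r \notin Fz).
by rewrite dims Ds dimr dimz dimt dimw.
Qed.

End Tower.

(** B1 and C each contribute a factor 3, and A, B2, D each a factor 2, so n = 3^i 2^j amounts to
    knowing how many conditions of each group hold. *)
Lemma degree_table (A B1 B2 C D : Prop) (a b1 b2 c d : bool) n :
  (A <-> a) -> (B1 <-> b1) -> (B2 <-> b2) -> (C <-> c) -> (D <-> d) ->
  (n = 2 ^ d * (3 ^ c * (2 ^ b2 * (3 ^ b1 * 2 ^ a))))%N <->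
      (n = 72%N /\ (B1 /\ C) /\ [/\ A, B2 & D]) \/
      (n = 36%N /\ (B1 /\ C) /\ two_of3 A B2 D) \/
      (n = 24%N /\ one_of2 B1 C /\ [/\ A, B2 & D]) \/
      (n = 18%N /\ (B1 /\ C) /\ one_of3 A B2 D) \/
      (n = 12%N /\ one_of2 B1 C /\ two_of3 A B2 D) \/
      (n = 9%N /\ (B1 /\ C) /\ none_of3 A B2 D) \/
      (n = 8%N /\ none_of2 B1 C /\ [/\ A, B2 & D]) \/
      (n = 6%N /\ one_of2 B1 C /\ one_of3 A B2 D) \/
      (n = 4%N /\ none_of2 B1 C /\ two_of3 A B2 D) \/
      (n = 3%N /\ one_of2 B1 C /\ none_of3 A B2 D) \/
      (n = 2%N /\ none_of2 B1 C /\ one_of3 A B2 D) \/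
      (n = 1%N /\ none_of2 B1 C /\ none_of3 A B2 D).
Proof.
move=> hA hB1 hB2 hC hD.
have and3E P Q R : [/\ P, Q & R] <-> P /\ Q /\ R by split=> [[]|[? []]].
have or3E P Q R : [\/ P, Q | R] <-> P \/ Q \/ R.
  by split=> [[] ?|[?|[?|?]]]; [left | right; left | right; right
    | constructor 1 | constructor 2 | constructor 3].
rewrite /two_of3 /one_of3 /none_of3 /one_of2 /none_of2 !or3E !and3E.
rewrite hA hB1 hB2 hC hD => {hA hB1 hB2 hC hD}.
by case: a; case: b1; case: b2; case: c; case: d => /=; intuition congruence.
Qed.

Theorem theorem5
    (K : fieldExtType rat) (Kbar : closedFieldType)
    (iota : {rmorphism K -> Kbar})
    (Kbar_alg : forall z : Kbar, algebraicOver iota z)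
    (c : K) (c_neq0 : c != 0)
    (z3 z7 : Kbar)
    (z3_prim : 3.-primitive_root z3) (z7_prim : 7.-primitive_root z7)
    (r s : Kbar)
    (r_cbrt : r ^+ 3 = delta1 z3 z7 * iota c)
    (s_sqrt : s ^+ 2 = (delta1 z3 z7 + 1) * iota c) :
  let K0 : Kbar -> Prop := field_image iota in
  let K7 : Kbar -> Prop := torsion_field K0 0 (iota c) 7 in
  let A : Prop := ~ K0 z3 in
  let B1 : Prop := ~ adjoin_seq K0 [:: z3] (z7 + z7^-1) in
  let B2 : Prop := ~ adjoin_seq K0 [:: z3; z7 + z7^-1] z7 in
  let C : Prop := ~ adjoin_seq K0 [:: z3; z7] r in
  let D : Prop := ~ adjoin_seq K0 [:: z3; z7] s in
  forall d : nat,
    has_degree K0 K7 d <->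
      (d = 72%N /\ (B1 /\ C) /\ [/\ A, B2 & D]) \/
      (d = 36%N /\ (B1 /\ C) /\ two_of3 A B2 D) \/
      (d = 24%N /\ one_of2 B1 C /\ [/\ A, B2 & D]) \/
      (d = 18%N /\ (B1 /\ C) /\ one_of3 A B2 D) \/
      (d = 12%N /\ one_of2 B1 C /\ two_of3 A B2 D) \/
      (d = 9%N /\ (B1 /\ C) /\ none_of3 A B2 D) \/
      (d = 8%N /\ none_of2 B1 C /\ [/\ A, B2 & D]) \/
      (d = 6%N /\ one_of2 B1 C /\ one_of3 A B2 D) \/
      (d = 4%N /\ none_of2 B1 C /\ two_of3 A B2 D) \/
      (d = 3%N /\ one_of2 B1 C /\ none_of3 A B2 D) \/
      (d = 2%N /\ none_of2 B1 C /\ one_of3 A B2 D) \/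
      (d = 1%N /\ none_of2 B1 C /\ none_of3 A B2 D).
Proof.
move=> K0 K7 A B1 B2 C D d.
have char0K : [pchar K] =i pred0.
  by move=> p; rewrite (pchar_lalg K) Num.Theory.pchar_num.
have char0 : [pchar Kbar] =i pred0.
  by move=> p; rewrite (fmorph_pchar iota) char0K.
have c0 : iota c != 0 by rewrite fmorph_eq0.
have hw := prim3_root z3_prim; have hz := prim7_root z7_prim.
rewrite !delta1_udelta in r_cbrt s_sqrt.
(* The four generators are pulled back to one finite extension M of K. *)
have [M [phi [S [phiK /esym]]]] := exists_finite_extension char0K Kbar_alg [::
  z3; z7; r; s].
case: S => [|w [|z [|r' [|s' [|? ?]]]]] // [Dw Dz Dr Ds].
have inj := fmorph_inj phi.
have phi_udelta : phi (udelta w z) = udelta z3 z7.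
  by rewrite rmorph_udelta Dw Dz.
have hw' : w ^+ 2 = - w - 1.
  by apply: inj; rewrite rmorphB rmorphN rmorph1 rmorphXn Dw.
have hz' : z ^+ 6 = - (z ^+ 5 + z ^+ 4 + z ^+ 3 + z ^+ 2 + z + 1).
  by apply: inj; rewrite rmorphN !rmorphD !rmorphXn rmorph1 Dz.
have r3 : r' ^+ 3 = 4 * udelta w z * c%:A.
  by apply: inj; rewrite rmorphXn !rmorphM rmorph_nat phi_udelta phiK Dr.
have s2 : s' ^+ 2 = (4 * udelta w z + 1) * c%:A.
  apply: inj; rewrite rmorphXn rmorphM rmorphD rmorph1 rmorphM rmorph_nat.
  by rewrite phi_udelta phiK Ds.
have [Fr Fs] : 4 * udelta w z * c%:A \in <<1 & [:: w; z]>>%VS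
    /\ (4 * udelta w z + 1) * c%:A \in <<1 & [:: w; z]>>%VS.
  apply: (@subfield_udelta _ (fun x => x \in <<1 & [:: w; z]>>%VS)).
  - split=> [|x y|x y|x]; first exact: rpred1.
    + exact: rpredB.
    + exact: rpredM.
    + by rewrite rpredV.
  - by apply: seqv_sub_adjoin; rewrite !inE eqxx.
  - by apply: seqv_sub_adjoin; rewrite !inE eqxx orbT.
  - by rewrite memvZ // rpred1.
have Dt : phi (z + z^-1) = z7 + z7^-1 by rewrite rmorphD fmorphV Dz.
(* Through [phi], each condition becomes non-membership in a subspace of M, which is a boolean. *)
have img S x y : phi x = y -> (~ adjoin_seq K0 (map phi S) y <-> x \notin <<1 &
  S>>%VS).
  move=> <-; rewrite (adjoin_seq_image phiK) mem_vspace_image.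
  by split=> [/negP | /negP].
have hA : A <-> w \notin 1%VS.
  rewrite /A /K0 -(vspace_image1 phiK) -Dw mem_vspace_image.
  by split=> [/negP | /negP].
have hB1 := img [:: w] _ _ Dt; have hB2 := img [:: w; z + z^-1] _ _ Dz.
have hC := img [:: w; z] _ _ Dr; have hD := img [:: w; z] _ _ Ds.
rewrite /= Dw ?Dt ?Dz in hB1 hB2 hC hD.
rewrite -(degree_table d hA hB1 hB2 hC hD) -dim_tower //; first last.
- by rewrite s2.
- by rewrite r3.
rewrite -(has_degree_image phiK) /has_degree.
have K7E v : K7 v <-> vspace_image phi <<1 & [:: w; z; r'; s']>> v.
  rewrite -(adjoin_seq_image phiK) /= Dw Dz Dr Ds.
  by apply: torsion_field_gen; rewrite //; exists c.
(* The two fields are only equivalent predicates, so the basis is carried across explicitly. *)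
by split=> -[e [Fe basis_e]]; exists e; split=> [i|v /K7E];
  [apply/K7E | | apply/K7E |]; eauto.
Qed.
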